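(* Let $n\ge 1$, let $\lambda$ be an $n$-partition, let $\pi\in S_n^\lambda$, and let $T\in\mathcal{T}_\lambda$. Then $S(T)=Y_\lambda(\pi)$ if and only if $T(l,k)\in C_\lambda(T,\pi;l,k)$ for all $(l,k)\in\lambda$.
   Context: Notation. Fix $n\ge 1$. For integers $p,q$, $[p,q]=\{p,p+1,\dots,q\}$ (empty if $p>q$). An $n$-partition is $\lambda=(\lambda_1\ge\dots\ge\lambda_n\ge 0)$, integers. Its shape has $\lambda_i$ left-justified boxes in row $i$ (row 1 at the top). The box in column $j$ and row $i$ is written $(j,i)\in\lambda$ (column index first). The column lengths are $\zeta_1,\dots,\zeta_{\lambda_1}$. A semistandard tableau $T$ of shape $\lambda$ is a filling with values $T(j,i)\in[1,n]$ such that $T(j,i)\le T(j+1,i)$ and $T(j,i)<T(j,i+1)$; $\mathcal{T}_\lambda$ is the set of these. Boundary conventions: $T(l+1,k):=n$ if $l=\lambda_k$; $T(l,k+1):=n+1$ if $k=\zeta_l$. $m(T)$ is the maximum of the values at the bottoms of the columns of $T$ (equivalently the maximum value of $T$); for the empty tableau, $m:=1$. Permutations and keys. $S_n$ is the set of $n$-tuples $\pi=(\pi_1,\dots,\pi_n)$ with distinct entries from $[1,n]$. Let $q_1<\dots<q_r$ be the distinct column lengths of $\lambda$, $q_0:=0$, $q_{r+1}:=n$. $S_n^\lambda$ is the set of $\pi\in S_n$ such that $\pi_i<\pi_j$ whenever $i<j$ both lie in $[q_{s-1}+1,q_s]$ for some $1\le s\le r+1$. The $\lambda$-key $Y=Y_\lambda(\pi)$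 is the tableau of shape $\lambda$ whose $j$th column consists of $\pi_1,\dots,\pi_{\zeta_j}$ sorted increasingly from top to bottom, with entries $Y(j,i)$. Scanning tableau. The earliest weakly increasing subsequence (EWIS) of a sequence $(x_1,x_2,\dots)$ is $(x_{i_1},x_{i_2},\dots)$ with $i_1=1$ and, for $j>1$, $i_j$ minimal with $i_j>i_{j-1}$ and $x_{i_{j-1}}\le x_{i_j}$. For $1\le l\le\lambda_1$, let $T^{(l,\zeta_l)}$ be $T$ with its first $l-1$ columns removed (column indexing retained). For $k=\zeta_l,\zeta_l-1,\dots,1$: read the bottom values of the nonempty columns of $T^{(l,k)}$ from left to right (starting with column $l$, whose bottom is at $(l,k)$), take the EWIS of this sequence, let the scanning path $P(T;l,k)$ be the sequence of locations of this EWIS, and let $S(T;l,k)$ be the last value of this EWIS; then let $T^{(l,k-1)}$ be the (semistandard) tableau obtained from $T^{(l,k)}$ by removing the boxes of $P(T;l,k)$. The scanning tableau $S(T)$ is the filling of $\lambda$ with value $S(T;l,k)$ at $(l,k)$. Let $U^{(l,k)}$ be $T^{(l,k)}$ with its leftmost remaining column (column $l$) removed. The sets $C$. Let $(l,k)\in\lambda$. If $l=\lambda_1$, then $C_\lambda(T,\pi;l,k):=\{Y(l,k)\}$. If $1\le l<\lambda_1$, write $U=U^{(l,k)}$. If $m(U)>Y(l,k)$, then $C_\lambda(T,\pi;l,k):=\emptyset$. If $m(U)=Y(l,k)$, then $C_\lambda(T,\pi;l,k):=[k,\min\{Y(l,k),T(l,k+1)-1,T(l+1,k)\}]$. If $m(U)<Y(l,k)$,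 then $C_\lambda(T,\pi;l,k):=\{Y(l,k)\}\cap[k,\min\{T(l,k+1)-1,T(l+1,k)\}]$. *)

(* Defs.v *)
From mathcomp Require Import all_boot.

Set Implicit Arguments.
Unset Strict Implicit.
Unset Printing Implicit Defensive.

(* All indices (rows, columns, positions in a sequence) are 1-based:
   [nth _ s i.-1] is item number [i] of [s], only meant for [1 <= i]. *)

Definition itv (p q : nat) : simpl_pred nat := [pred x | p <= x <= q].

(** * Partitions and shapes *)

Definition npartition (lam : seq nat) : bool := sorted geq lam.

Definition row_len (lam : seq nat) (i : nat) : nat := nth 0 lam i.-1.

Definition col_len (lam : seq nat) (j : nat) : nat := count (leq j) lam.

(* A box is written (column, row). *)
Definition in_shape (lam : seq nat) (j i : nat) : bool :=
  [&& 1 <= j, 1 <= i & j <= row_len lam i].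

(** * Tableaux *)

(* A filling is the sequence of its columns, each listed from top to bottom.
   Columns may be empty: when boxes or whole columns are removed, the emptied
   columns are kept in place as [[::]], so that column indices never shift. *)
Definition filling := seq (seq nat).

Definition column (T : filling) (j : nat) : seq nat := nth [::] T j.-1.

Definition entry (T : filling) (j i : nat) : nat := nth 0 (column T j) i.-1.

Definition has_shape (lam : seq nat) (T : filling) : Prop :=
  size T = row_len lam 1 /\
  forall j, 1 <= j <= row_len lam 1 -> size (column T j) = col_len lam j.

Definition semistandard (n : nat) (lam : seq nat) (T : filling) : Prop :=
  [/\ has_shape lam T,
      forall j i, in_shape lam j i -> entry T j i \in itv 1 n,
      forall j i, in_shape lam j i -> in_shape lam j.+1 i ->
        entry T j i <= entry T j.+1 i
    & forall j i, in_shape lam j i -> in_shape lam j i.+1 ->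
        entry T j i < entry T j i.+1].

(* T(l+1,k) and T(l,k+1), with their boundary conventions. *)
Definition right_entry (n : nat) (lam : seq nat) (T : filling) (l k : nat) :=
  if l == row_len lam k then n else entry T l.+1 k.

Definition below_entry (n : nat) (lam : seq nat) (T : filling) (l k : nat) :=
  if k == col_len lam l then n.+1 else entry T l k.+1.

Definition bottom_boxes (T : filling) : seq (nat * nat) :=
  [seq (j, size (column T j)) | j <- iota 1 (size T) & column T j != [::]].

Definition box_value (T : filling) (b : nat * nat) : nat := entry T b.1 b.2.

Definition max_bottom (T : filling) : nat :=
  if bottom_boxes T is [::] then 1
  else \max_(b <- bottom_boxes T) box_value T b.

(** * Permutations and keys *)

Definition permutation (n : nat) (pi : n.-tuple nat) : bool :=
  uniq pi && all [in itv 1 n] pi.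

Definition distinct_col_lens (lam : seq nat) : seq nat :=
  sort leq (undup [seq col_len lam j | j <- iota 1 (row_len lam 1)]).

(* q_0 = 0 < q_1 < ... < q_r and q_{r+1} = n. *)
Definition qlen (n : nat) (lam : seq nat) (s : nat) : nat :=
  nth 0 (0 :: rcons (distinct_col_lens lam) n) s.

Definition lam_permutation (n : nat) (lam : seq nat) (pi : n.-tuple nat) :=
  permutation pi /\
  forall s i j, 1 <= s <= (size (distinct_col_lens lam)).+1 ->
    i \in itv (qlen n lam s.-1).+1 (qlen n lam s) ->
    j \in itv (qlen n lam s.-1).+1 (qlen n lam s) ->
    i < j -> nth 0 pi i.-1 < nth 0 pi j.-1.

Definition key (lam pi : seq nat) : filling :=
  [seq sort leq (take (col_len lam j) pi) | j <- iota 1 (row_len lam 1)].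

(** * The scanning tableau *)

(* Earliest weakly increasing subsequence, for items compared through [f]. *)
Fixpoint ewis_above (A : Type) (f : A -> nat) (v : nat) (s : seq A) : seq A :=
  if s is x :: s' then
    if v <= f x then x :: ewis_above f (f x) s' else ewis_above f v s'
  else [::].

Definition ewis (A : Type) (f : A -> nat) (s : seq A) : seq A :=
  if s is x :: s' then x :: ewis_above f (f x) s' else [::].

Definition remove_columns (p : nat) (T : filling) : filling :=
  [seq if j <= p then [::] else column T j | j <- iota 1 (size T)].

(* Only used for a set [P] of bottoms of columns: a column loses its last item
   exactly when its bottom box is in [P]. *)
Definition remove_boxes (P : seq (nat * nat)) (T : filling) : filling :=
  [seq if (j, size (column T j)) \in P
       then take (size (column T j)).-1 (column T j) else column T j
  | j <- iota 1 (size T)].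

Definition first_path (T : filling) : seq (nat * nat) :=
  ewis (box_value T) (bottom_boxes T).

(* T^{(l,k)}, for 1 <= k <= zeta_l. *)
Definition remaining (T : filling) (l k : nat) : filling :=
  iter (size (column T l) - k) (fun T' => remove_boxes (first_path T') T')
    (remove_columns l.-1 T).

Definition scan_path (T : filling) (l k : nat) : seq (nat * nat) :=
  first_path (remaining T l k).

Definition scan_value (T : filling) (l k : nat) : nat :=
  last 0 [seq box_value T b | b <- scan_path T l k].

Definition scanning (T : filling) : filling :=
  [seq [seq scan_value T l k | k <- iota 1 (size (column T l))]
  | l <- iota 1 (size T)].

(* U^{(l,k)}; the columns of T^{(l,k)} before column l are already empty. *)
Definition remaining_right (T : filling) (l k : nat) : filling :=
  remove_columns l (remaining T l k).

(** * The sets C *)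

Definition Cset (n : nat) (lam : seq nat) (T : filling) (pi : seq nat)
    (l k : nat) : simpl_pred nat :=
  let y := entry (key lam pi) l k in
  let below := below_entry n lam T l k in
  let right := right_entry n lam T l k in
  let m := max_bottom (remaining_right T l k) in
  if l == row_len lam 1 then pred1 y
  else if y < m then pred0
  else if m == y then itv k (minn y (minn (below - 1) right))
  else [predI pred1 y & itv k (minn (below - 1) right)].

(* Main.v *)
Require Import Defs.
From mathcomp Require Import all_boot.

(* The earliest weakly increasing subsequence consists of the weak left-to-right
   maxima, so its last value is the maximum of the whole sequence.  Since
   (l, k) is the bottom of the first nonempty column of T^{(l,k)}, this gives
   S(T; l, k) = max (T(l, k), m(U^{(l,k)})), and the condition
   S(T; l, k) = Y(l, k) can be compared with T(l, k) \in C_lambda(T, pi; l, k)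
   box by box: the bounds in C other than Y(l, k) hold for every semistandard
   tableau. *)

Lemma last_ewis_above (A : Type) (f : A -> nat) (s : seq A) (v : nat) :
  last v [seq f x | x <- ewis_above f v s] = maxn v (\max_(x <- s) f x).
Proof.
elim: s v => [|x s IHs] v /=; first by rewrite big_nil maxn0.
rewrite big_cons maxnA; case: leqP => [le_v|lt_v] /=; exact: IHs.
Qed.

(** Allows values read in a partly emptied tableau to be traded for values in [T]: the two agree
    only on the boxes being read. *)
Lemma eq_in_ewis_above (A : eqType) (f g : A -> nat) (v : nat) (s : seq A) :
  {in s, f =1 g} -> ewis_above f v s = ewis_above g v s.
Proof.
elim: s v => [|x s IHs] v //= fg; rewrite -fg ?mem_head //.
by rewrite !IHs // => y ys; apply: fg; rewrite inE ys orbT.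
Qed.

Lemma column_map_iota (F : nat -> seq nat) (s j : nat) :
  0 < j ->
  column [seq F i | i <- iota 1 s] j = if j <= s then F j else [::].
Proof.
case: j => // j _; rewrite /column /=; case: ltnP => [lt_js | le_sj].
  by rewrite (nth_map 0) ?size_iota // nth_iota.
by rewrite nth_default // size_map size_iota.
Qed.

Lemma column_remove_columns (p : nat) (T : filling) (j : nat) :
  0 < j -> column (remove_columns p T) j = if j <= p then [::] else column T j.
Proof.
move=> j_gt0; rewrite column_map_iota //; case: leqP => // lt_Tj.
by rewrite /column nth_default ?if_same //; case: j lt_Tj {j_gt0}.
Qed.

Lemma column_remove_boxes (P : seq (nat * nat)) (T : filling) (j : nat) :
  0 < j ->
  column (remove_boxes P T) j =
    if (j, size (column T j)) \in P
    then take (size (column T j)).-1 (column T j) else column T j.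
Proof.
move=> j_gt0; rewrite column_map_iota //; case: leqP => // lt_Tj.
have ->: column T j = [::] by rewrite /column nth_default //; case: j lt_Tj {j_gt0}.
by rewrite if_same.
Qed.

Lemma column_neq_nil (T : filling) (j : nat) :
  0 < j -> column T j != [::] -> j <= size T.
Proof.
case: j => // j _; apply: contraNT; rewrite -ltnNge ltnS => le_Tj.
by rewrite /column nth_default.
Qed.

(** Boxes are only ever lost from the bottom of a column, so a surviving box keeps its row index and
    its value. *)
Lemma box_value_bottom (R T : filling) :
  (forall j, 0 < j -> prefix (column R j) (column T j)) ->
  {in bottom_boxes R, box_value R =1 box_value T}.
Proof.
move=> RT b /mapP[j]; rewrite mem_filter mem_iota => /and3P[Rj j_gt0 _] ->.
rewrite /box_value /entry /=; case/prefixP: (RT j j_gt0) => s ->.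
by rewrite nth_cat ltn_predL lt0n size_eq0 Rj.
Qed.

(** Isolates the box from which every scanning path starts; the other bottoms are those of the
    tableau called U in the definition of C. *)
Lemma bottom_boxes_first (T : filling) (l : nat) :
  0 < l -> (forall j, 0 < j < l -> column T j = [::]) -> column T l != [::] ->
  bottom_boxes T = (l, size (column T l)) :: bottom_boxes (remove_columns l T).
Proof.
move=> l_gt0 before_l col_l; have le_lT := column_neq_nil _ _ l_gt0 col_l.
have split_iota: iota 1 (size T)
    = iota 1 l.-1 ++ l :: iota l.+1 (size T - l).
  have ->: size T = l.-1 + (1 + (size T - l)).
    by rewrite addnA addn1 prednK // subnKC.
  by rewrite !iotaD add1n prednK // addn1 addnA addn1 prednK // addKn.
have before_nil (F : pred nat) : {in iota 1 l.-1, F =1 xpred0} ->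
    [seq j <- iota 1 l.-1 | F j] = [::].
  by move=> F0; rewrite (eq_in_filter F0) filter_pred0.
have after j : j \in iota l.+1 (size T - l) ->
    column (remove_columns l T) j = column T j.
  rewrite mem_iota => /andP[lt_lj _].
  by rewrite column_remove_columns ?(leq_ltn_trans _ lt_lj) // leqNgt lt_lj.
rewrite /bottom_boxes size_map size_iota split_iota !filter_cat !before_nil /=.
- rewrite col_l column_remove_columns // leqnn /=; congr (_ :: _).
  rewrite -(@eq_in_filter _ (fun j => column (remove_columns l T) j != [::]));
    last by move=> j /after ->.
  apply/eq_in_map => j; rewrite mem_filter => /andP[_ /after -> //].
- move=> j; rewrite mem_iota add1n prednK // => /andP[j_gt0 lt_jl].
  by rewrite column_remove_columns // ltnW.
- move=> j; rewrite mem_iota add1n prednK // => j_lt_l.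
  by rewrite before_l.
Qed.

(** An EWIS always keeps its first item, here the bottom of column [l], so each round removes
    exactly one box from that column. All [j <= l] are treated in one induction because locating
    this first item needs the earlier columns to be empty. *)
Lemma column_remaining (T : filling) (l k j : nat) :
  0 < j <= l -> k <= size (column T l) ->
  column (remaining T l k) j = if j < l then [::] else take k (column T l).
Proof.
rewrite /remaining => j_le_l le_kz; set z := size (column T l).
have l_gt0 : 0 < l by case/andP: j_le_l; apply: leq_trans.
(* The induction is on the number [z - k] of rounds performed. *)
have ->: take k (column T l) = take (z - (z - k)) (column T l) by rewrite subKn.
have: z - k <= z by exact: leq_subr.
elim: (z - k) j j_le_l => [|m IHm] j /andP[j_gt0 le_jl] le_mz.
  rewrite column_remove_columns // subn0 take_size -ltnS prednK //.
  by case: ltngtP le_jl => // ->.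
rewrite iterS; set R := iter m _ _ in IHm *.
have col_l : column R l = take (z - m) (column T l).
  by rewrite IHm ?l_gt0 ?leqnn ?ltnn ?(ltnW le_mz).
have size_l : size (column R l) = z - m by rewrite col_l size_takel ?leq_subr.
rewrite column_remove_boxes //; case: ltnP => [lt_jl | le_lj].
  by rewrite IHm ?j_gt0 ?(ltnW le_mz) // lt_jl /= if_same.
have -> : j = l by apply/eqP; rewrite eqn_leq le_jl.
rewrite /first_path (bottom_boxes_first _ _ l_gt0).
- rewrite /= in_cons eqxx /= size_l col_l take_takel ?leq_pred //.
  by rewrite subnS.
- by move=> i /andP[i_gt0 lt_il]; rewrite IHm ?lt_il ?i_gt0 ?(ltnW lt_il) ?(ltnW le_mz).
(* Fewer than [z] rounds have been performed, so column [l] is not yet exhausted. *)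
- by rewrite -size_eq0 size_l subn_eq0 -ltnNge.
Qed.

Lemma prefix_remaining (T : filling) (l k j : nat) :
  0 < j -> prefix (column (remaining T l k) j) (column T j).
Proof.
move=> j_gt0; rewrite /remaining; elim: (_ - k) => [|m IHm].
  by rewrite column_remove_columns //; case: ifP; rewrite ?prefix0s ?prefix_refl.
rewrite iterS column_remove_boxes //; case: ifP => // _.
exact: prefix_trans (prefix_take _ _) IHm.
Qed.

Lemma scan_value_max (T : filling) (l k : nat) :
  0 < l -> 0 < k <= size (column T l) -> 0 < entry T l k ->
  scan_value T l k = maxn (entry T l k) (max_bottom (remaining_right T l k)).
Proof.
move=> l_gt0 /andP[k_gt0 le_kz] t_gt0.
rewrite /scan_value /scan_path /first_path /remaining_right.
set R := remaining T l k; set U := remove_columns l R.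
have col_l : column R l = take k (column T l).
  by rewrite column_remaining ?l_gt0 ?leqnn ?ltnn.
have size_l : size (column R l) = k by rewrite col_l size_takel.
have boxR := box_value_bottom _ _ (prefix_remaining T l k).
have boxU : {in bottom_boxes U, box_value U =1 box_value T}.
  apply: box_value_bottom => j j_gt0; rewrite column_remove_columns //.
  by case: ifP; rewrite ?prefix0s ?prefix_remaining.
have first_R : bottom_boxes R = (l, k) :: bottom_boxes U.
  rewrite -size_l; apply: bottom_boxes_first => //.
    move=> j /andP[j_gt0 lt_jl].
    by rewrite column_remaining ?j_gt0 ?(ltnW lt_jl) // lt_jl.
  by rewrite -size_eq0 size_l -lt0n.
rewrite first_R /= boxR ?first_R ?mem_head //.
rewrite (@eq_in_ewis_above _ _ (box_value T)) => [|b bU]; last first.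
  by apply: boxR; rewrite first_R inE bU orbT.
(* The maximum, now expressed with values in [T], is turned back into values in [U] to match
   [max_bottom]. *)
rewrite last_ewis_above -(eq_big_seq _ boxU) /max_bottom.
(* For empty [U] the convention gives 1 where the empty maximum is 0; positivity of the entry makes
   this harmless. *)
by case: (bottom_boxes U) => //; rewrite big_nil maxn0; apply/esym/maxn_idPl.
Qed.

Lemma max_bottom_remove_all (T : filling) (p : nat) :
  size T <= p -> max_bottom (remove_columns p T) = 1.
Proof.
move=> le_Tp; rewrite /max_bottom /bottom_boxes.
rewrite (@eq_in_filter _ _ pred0) ?filter_pred0 // => j.
rewrite size_map size_iota mem_iota add1n ltnS => /andP[j_gt0 le_jT].
by rewrite column_remove_columns // (leq_trans le_jT).
Qed.

Lemma size_remaining (T : filling) (l k : nat) :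
  size (remaining T l k) = size T.
Proof.
rewrite /remaining; elim: (_ - _) => [|m IHm] /=; rewrite size_map size_iota //.
Qed.

(** Row lengths decrease weakly, so the rows reaching column [j] form an initial segment and
    counting them locates its end. *)
Lemma leq_col_len (lam : seq nat) (j i : nat) :
  npartition lam -> 0 < j -> 0 < i ->
  (i <= col_len lam j) = (j <= row_len lam i).
Proof.
rewrite /npartition /col_len /row_len => + j_gt0; case: i => // i + _ /=.
elim: lam i => [|x s IHs] i /= lam_s; first by rewrite nth_nil [RHS]leqNgt j_gt0.
have le_sx : all (geq x) s.
  by apply: order_path_min lam_s => y z w le_zy le_wz; apply: leq_trans le_wz le_zy.
case: i => [|i] /=; last first.
  rewrite -IHs ?(path_sorted lam_s) //; case: (leqP j x) => // lt_xj.
  (* The first row is already shorter than [j], hence so are all later ones. *)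
  have -> : count (leq j) s = 0; last by [].
  apply/eqP; rewrite -leqn0 leqNgt -has_count; apply/hasPn => y /(allP le_sx).
  by rewrite -ltnNge => /leq_ltn_trans; apply.
case: (leqP j x) => //= lt_xj; rewrite add0n -has_count; apply/hasPn => y.
by move/(allP le_sx); rewrite -ltnNge => /leq_ltn_trans; apply.
Qed.

(** Passes from rows to columns, the form in which fillings are stored. *)
Lemma in_shapeE (lam : seq nat) (j i : nat) :
  npartition lam ->
  in_shape lam j i = (0 < j <= row_len lam 1) && (0 < i <= col_len lam j).
Proof.
move=> lamP; rewrite /in_shape.
case: j => //= j; case: i => [|i] /=; first by rewrite andbF.
rewrite -!leq_col_len //; case: (ltnP i) => [lt_i|]; last by rewrite andbF.
by rewrite (leq_ltn_trans _ lt_i).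
Qed.

Lemma eq_filling (lam : seq nat) (A B : filling) :
  npartition lam -> has_shape lam A -> has_shape lam B ->
  (A = B <-> forall l k, in_shape lam l k -> entry A l k = entry B l k).
Proof.
move=> lamP [sA cA] [sB cB]; split=> [-> // | AB].
apply: (@eq_from_nth _ [::]); rewrite ?sA ?sB // => l lt_l.
have := cA l.+1 lt_l; have := cB l.+1 lt_l; rewrite /column /= => zB zA.
apply: (@eq_from_nth _ 0); rewrite ?zA ?zB // => k lt_k.
by apply: (AB l.+1 k.+1); rewrite in_shapeE //= lt_l.
Qed.

Lemma has_shape_map_iota (lam : seq nat) (F : nat -> seq nat) :
  (forall j, 0 < j <= row_len lam 1 -> size (F j) = col_len lam j) ->
  has_shape lam [seq F j | j <- iota 1 (row_len lam 1)].
Proof.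
move=> szF; split=> [|j j_in]; first by rewrite size_map size_iota.
have /andP[j_gt0 le_j] := j_in.
by rewrite column_map_iota // le_j szF.
Qed.

(** These are the constraints in C that do not involve the key. The lower bound [k] comes from
    strict increase down a column starting at 1 or more; at the ends of columns and rows the
    conventions reduce the upper bounds to [n]. *)
Lemma semistandard_bounds (n : nat) (lam : seq nat) (T : filling) (l k : nat) :
  npartition lam -> semistandard n lam T -> in_shape lam l k ->
  [/\ 0 < entry T l k, k <= entry T l k,
      entry T l k <= below_entry n lam T l k - 1
    & entry T l k <= right_entry n lam T l k].
Proof.
move=> lamP [_ T_in T_row T_col] lk.
have /andP[T_gt0 T_le_n] := T_in _ _ lk.
have /and3P[l_gt0 k_gt0 le_l] := lk.
have:= lk; rewrite in_shapeE // => /andP[l_in /andP[_ le_k]].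
split=> //.
- elim: k lk {T_gt0 T_le_n le_l le_k} k_gt0 => // k IHk lk _.
  case: (posnP k) => [k0 | k_gt0]; first by have /andP[] := T_in _ _ lk; rewrite k0.
  have lk' : in_shape lam l k.
    by move: lk; rewrite !in_shapeE // l_in k_gt0 => /= /ltnW.
  exact: leq_ltn_trans (IHk lk' k_gt0) (T_col _ _ lk' lk).
- rewrite /below_entry; case: eqVneq => [_|ne_k]; first by rewrite subn1.
  have lt_T : entry T l k < entry T l k.+1.
    by apply: T_col; rewrite // in_shapeE // l_in /= ltn_neqAle ne_k.
  by rewrite subn1 -ltnS (ltn_predK lt_T).
- rewrite /right_entry; case: eqVneq => // ne_l.
  by apply: T_row; rewrite // /in_shape /= k_gt0 ltn_neqAle ne_l.
Qed.

Theorem theorem6p1 (n : nat) (n_ge1 : 1 <= n) (lam pi : n.-tuple nat)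
    (T : filling) :
  npartition lam -> lam_permutation lam pi -> semistandard n lam T ->
  (scanning T = key lam pi <->
   forall l k, in_shape lam l k -> entry T l k \in Cset n lam T pi l k).
Proof.
move=> lamP _ Tss; have [[sT cT] _ _ _] := Tss.
have scan_shape : has_shape lam (scanning T).
  rewrite /scanning sT; apply: has_shape_map_iota => j j_in.
  by rewrite size_map size_iota cT.
have key_shape : has_shape lam (key lam pi).
  (* The prefix of [pi] is long enough: a column length counts some of the [n] parts of [lam]. *)
  apply: has_shape_map_iota => j _; rewrite size_sort size_takel // size_tuple.
  by rewrite -{2}(size_tuple lam) count_size.
suff boxP l k : in_shape lam l k ->
    (entry (scanning T) l k == entry (key lam pi) l k)
      = (entry T l k \in Cset n lam T pi l k).
  apply: iff_trans (eq_filling _ _ _ lamP scan_shape key_shape) _.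
  by split=> H l k lk; [rewrite -boxP // H | apply/eqP; rewrite boxP // H].
move=> lk; have [T_gt0 le_kT T_below T_right] := semistandard_bounds _ _ _ _ _ lamP Tss lk.
move: lk; rewrite in_shapeE // => /andP[l_in /andP[k_gt0 le_k]].
have /andP[l_gt0 le_l] := l_in.
have -> : entry (scanning T) l k = scan_value T l k.
  rewrite {1}/entry column_map_iota // sT le_l (nth_map 0) ?size_iota cT ?prednK //.
  by rewrite nth_iota ?prednK // add1n prednK.
rewrite scan_value_max ?cT ?k_gt0 // /Cset; set m := max_bottom _.
set y := entry (key _ _) _ _.
case: (eqVneq l) => [l_last | _].
  (* Nothing lies to the right of the last column, so the scan value is the entry itself. *)
  have m1 : m = 1 by apply: max_bottom_remove_all; rewrite size_remaining sT l_last.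
  by rewrite m1 inE (maxn_idPl T_gt0).
case: ltnP => [lt_ym | le_my].
  (* The scan value is at least [m], hence exceeds [y], and C is empty. *)
  by rewrite inE; apply: gtn_eqF; rewrite leq_max lt_ym orbT.
case: (eqVneq m) => [-> | ne_my].
  (* With [m = y], the scan value is [y] exactly when the entry is at most [y]. *)
  by rewrite inE /= !leq_min le_kT T_below T_right !andbT -(sameP maxn_idPr eqP).
rewrite !inE /= leq_min le_kT T_below T_right !andbT.
(* Here [m < y]. If the entry exceeds [m], it is the scan value; otherwise both the scan value [m]
   and the entry are below [y], so both sides fail. *)
case: leqP => // le_Tm; rewrite (negPf ne_my).
by rewrite ltn_eqF // (leq_ltn_trans le_Tm) // ltn_neqAle ne_my.
Qed.
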